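(* Let $p_{C_1}(z,w)=(1+w^2)(1-z)^2-w(6+20z+6z^2)$. Then $$2\pi\,\mathrm{m}(p_{C_1})=16\,D\!\left((1+\sqrt2)i\right)+2\pi\log(1+\sqrt2),$$ and in particular $10\,v_{\mathrm{tet}}+2\,v_{\mathrm{oct}}<2\pi\,\mathrm{m}(p_{C_1})$.
   Context: Mahler measure: $\mathrm{m}(P)=\frac{1}{(2\pi i)^2}\int_{|z|=|w|=1}\log|P(z,w)|\frac{dz}{z}\frac{dw}{w}$. $D$ is the Bloch–Wigner dilogarithm $D(z)=\operatorname{Im}(\mathrm{Li}_2(z))+\arg(1-z)\log|z|$, $\mathrm{Li}_2(z)=-\int_0^z\frac{\log(1-t)}{t}dt$. $v_{\mathrm{tet}}=D(e^{i\pi/3})\approx1.01494$, $v_{\mathrm{oct}}=4D(i)\approx3.66386$. *)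

(* Defs.v *)
From Stdlib Require Import Reals Lra ClassicalEpsilon.
Open Scope R_scope.

Definition C := (R * R)%type.
Definition Cre (z : C) : R := fst z.
Definition Cim (z : C) : R := snd z.
Definition Cof (x : R) : C := (x, 0).
Definition Cadd (z w : C) : C := (fst z + fst w, snd z + snd w).
Definition Csub (z w : C) : C := (fst z - fst w, snd z - snd w).
Definition Cmul (z w : C) : C :=
  (fst z * fst w - snd z * snd w, fst z * snd w + snd z * fst w).
Definition Cnorm2 (z : C) : R := fst z * fst z + snd z * snd z.
Definition Cabs (z : C) : R := sqrt (Cnorm2 z).
Definition Cexpi (t : R) : C := (cos t, sin t).

Definition Carg (z : C) : R :=
  let x := fst z in let y := snd z in
  if Rlt_dec 0 x then atan (y / x)
  else if Rlt_dec x 0 then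
    (if Rle_dec 0 y then atan (y / x) + PI else atan (y / x) - PI)
  else if Rlt_dec 0 y then PI / 2
  else if Rlt_dec y 0 then - (PI / 2)
  else 0.

Definition is_RInt (f : R -> R) (a b v : R) : Prop :=
  exists pr : Riemann_integrable f a b, RiemannInt pr = v.

Definition RInt (f : R -> R) (a b : R) : R :=
  epsilon (inhabits 0) (fun v => is_RInt f a b v).

(** Im Li_2(z), with Li_2(z) = - int_0^z log(1-t)/t dt (principal branch),
    integrated along the segment t = s z, s in [0,1]:
    Li_2(z) = - int_0^1 Log(1 - s z) / s ds, so
    Im Li_2(z) = - int_0^1 Arg(1 - s z) / s ds. *)
Definition ImLi2 (z : C) : R :=
  - RInt (fun s => Carg (Csub (Cof 1) (Cmul (Cof s) z)) / s) 0 1.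

Definition BW (z : C) : R :=
  ImLi2 z + Carg (Csub (Cof 1) z) * ln (Cabs z).

Definition v_tet : R := BW (Cexpi (PI / 3)).
Definition v_oct : R := 4 * BW (0, 1).

(** Mahler measure of a two-variable function P (e.g. a polynomial).
    m(P) = 1/(4 pi^2) int_0^{2pi} int_0^{2pi} log|P(e^{it}, e^{iu})| du dt.
    Since log|P| may have (integrable) logarithmic singularities on the torus,
    the integral is taken as the (Lebesgue, via monotone convergence) limit of
    the Riemann integrals of the continuous truncations max(log|P|, -N). *)
Definition log_trunc (P : C -> C -> C) (N : nat) (t u : R) : R :=
  ln (Rmax (Cnorm2 (P (Cexpi t) (Cexpi u))) (exp (- 2 * INR N))) / 2.

Definition mahler_trunc_is (P : C -> C -> C) (N : nat) (v : R) : Prop :=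
  exists F : R -> R,
    (forall t, is_RInt (fun u => log_trunc P N t u) 0 (2 * PI) (F t)) /\
    is_RInt F 0 (2 * PI) (4 * PI ^ 2 * v).

Definition is_mahler_measure (P : C -> C -> C) (m : R) : Prop :=
  exists v : nat -> R, (forall N, mahler_trunc_is P N (v N)) /\ Un_cv v m.

Definition pC1 (z w : C) : C :=
  Csub (Cmul (Cadd (Cof 1) (Cmul w w)) (Cmul (Csub (Cof 1) z) (Csub (Cof 1) z)))
       (Cmul w (Cadd (Cadd (Cof 6) (Cmul (Cof 20) z)) (Cmul (Cof 6) (Cmul z z)))).

(* Main.v *)
Require Import Defs.
From Stdlib Require Import Reals Lra Nsatz.
From Coquelicot Require Import Coquelicot.
Open Scope R_scope.
Set Bullet Behavior "Strict Subproofs".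

(** On the torus [|pC1|] equals
    [20 + 4 cos u + (12 - 4 cos u) cos t] with [z = e^(it)], [w = e^(iu)], which vanishes only at
    [t = u = PI].  Integrating in [t] first, Jensen's formula produces a perfect square and gives
    [2 PI m = 8 K] with [K = int_0^(PI/2) ln (2 sqrt 2 + 2 cos th)].  For [r + 1/r = 2 sqrt 2] the
    argument of the logarithm is [|1 + r e^(i th)|^2 / r], and differentiating
    [int_0^al ln |1 + r e^(i th)|^2] in [r] turns it into the arctangent integral defining
    [Im Li_2].  Taking [r = 1 + sqrt 2] gives the closed form, while the other root
    [r = sqrt 2 - 1] gives a rapidly convergent expression for the lower bound; [al = 2 PI / 3]
    and [r = 1] gives [v_tet]. *)

(** * Integrals depending on a parameter *)

Lemma continuity_2d_pt_swap (f : R -> R -> R) (x y : R) :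
  continuity_2d_pt f x y -> continuity_2d_pt (fun u v => f v u) y x.
Proof.
  intros H eps. destruct (H eps) as [d Hd].
  exists d. intros u v Hu Hv. now apply Hd.
Qed.

Lemma continuity_2d_pt_slice (f : R -> R -> R) (x y : R) :
  continuity_2d_pt f x y -> continuous (f x) y.
Proof.
  intros H. apply continuity_pt_filterlim, continuity_pt_locally.
  intros eps. destruct (H eps) as [d Hd]. exists d. intros v Hv.
  apply Hd; [|exact Hv]. rewrite Rminus_diag, Rabs_R0. apply cond_pos.
Qed.

Lemma ex_RInt_continuous_le (f : R -> R) (a b : R) :
  a <= b -> (forall x, a <= x <= b -> continuous f x) -> ex_RInt f a b.
Proof.
  intros Hab H. apply (@ex_RInt_continuous R_CompleteNormedModule).
  intros x. rewrite Rmin_left, Rmax_right by exact Hab. apply H.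
Qed.

Lemma continuous_RInt_param (f : R -> R -> R) (a b c : R) :
  a <= b ->
  (forall t, a <= t <= b -> continuity_2d_pt f c t) ->
  locally c (fun x => ex_RInt (f x) a b) ->
  continuous (fun x => RInt (f x) a b) c.
Proof.
  intros Hab Hf Hex.
  apply continuity_pt_filterlim, continuity_pt_locally. intros eps.
  (* The added 1 keeps the quotient defined when [a = b]. *)
  assert (Heps : 0 < eps / (b - a + 1)).
  { apply Rdiv_lt_0_compat; [apply cond_pos | lra]. }
  destruct (uniform_continuity_2d_1d' f a b c Hf (mkposreal _ Heps)) as [d Hd].
  destruct Hex as [d' Hd']. pose proof (locally_singleton _ _ (ex_intro _ d' Hd')) as Hc.
  pose proof (cond_pos d) as d0. pose proof (cond_pos d') as d0'.
  exists (mkposreal _ (Rmin_pos _ _ d0 d0')). intros x Hx.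
  change (Rabs (x - c) < Rmin d d') in Hx.
  assert (Hx1 : Rabs (x - c) < d) by (eapply Rlt_le_trans; [exact Hx | apply Rmin_l]).
  assert (Hx2 : ex_RInt (f x) a b).
  { apply Hd'. eapply Rlt_le_trans; [exact Hx | apply Rmin_r]. }
  apply Rabs_def2 in Hx1.
  replace (RInt (f x) a b - RInt (f c) a b) with (RInt (fun t => f x t - f c t) a b)
    by (apply (RInt_minus (f x) (f c)); assumption).
  apply Rle_lt_trans with ((b - a) * (eps / (b - a + 1))).
  - apply abs_RInt_le_const; [exact Hab | apply (ex_RInt_minus (f x) (f c)); assumption |].
    intros t Ht. left.
    refine (Hd t c t x _ _ _ _ _); try lra.
    rewrite Rminus_diag, Rabs_R0. exact d0.
  - pose proof (cond_pos eps). apply Rmult_lt_reg_r with (b - a + 1); [lra|].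
    field_simplify; nra.
Qed.

(** Fubini for continuous integrands: as functions of the upper limit of the [t]-integral, both
    sides vanish at [a] and have derivative [RInt (f x) c d], the right one by differentiation under
    the integral sign. *)
Lemma RInt_swap_order (f : R -> R -> R) (a b c d : R) :
  a <= b -> c <= d ->
  (forall x y, continuity_2d_pt f x y) ->
  RInt (fun t => RInt (fun u => f t u) c d) a b
  = RInt (fun u => RInt (fun t => f t u) a b) c d.
Proof.
  intros Hab Hcd Hf.
  assert (Hex2 : forall x y z, ex_RInt (fun t => f t z) x y).
  { intros x y z. apply (@ex_RInt_continuous R_CompleteNormedModule). intros t _.
    now apply (continuity_2d_pt_slice (fun u v => f v u)), continuity_2d_pt_swap. }
  assert (Hex1 : forall x, ex_RInt (f x) c d).
  { intros x. apply ex_RInt_continuous_le; [exact Hcd|]. intros t _.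
    now apply continuity_2d_pt_slice. }
  assert (HexP : forall x y, x <= y -> ex_RInt (fun u => RInt (fun t => f t u) x y) c d).
  { intros x y Hxy. apply ex_RInt_continuous_le; [exact Hcd|]. intros z _.
    apply (continuous_RInt_param (fun u t => f t u)); [exact Hxy | |].
    - intros t _. now apply continuity_2d_pt_swap.
    - apply filter_forall. intros u. apply Hex2. }
  (* Upper limits below [a] occur too, because the derivative at [a] needs a two-sided
     neighbourhood. *)
  assert (HexP' : forall x, ex_RInt (fun u => RInt (fun t => f t u) a x) c d).
  { intros x. destruct (Rle_dec a x) as [Hx|Hx]; [now apply HexP|].
    apply (ex_RInt_ext (fun u => - RInt (fun t => f t u) x a)).
    - intros u _. apply (opp_RInt_swap (fun t => f t u)), Hex2.
    - apply (ex_RInt_opp (fun u => RInt (fun t => f t u) x a)), HexP. lra. }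
  assert (Hd : forall x z, is_derive (fun y => RInt (fun t => f t z) a y) x (f x z)).
  { intros x z. apply (is_derive_RInt (fun t => f t z) _ a).
    - apply filter_forall. intros y. apply (@RInt_correct R_CompleteNormedModule), Hex2.
    - now apply (continuity_2d_pt_slice (fun u v => f v u)), continuity_2d_pt_swap. }
  assert (HD : forall x, is_derive
    (fun y => RInt (fun u => RInt (fun t => f t u) a y) c d) x (RInt (f x) c d)).
  { intros x.
    replace (RInt (f x) c d)
      with (RInt (fun u => Derive (fun y => RInt (fun t => f t u) a y) x) c d)
      by (apply RInt_ext; intros u _; apply is_derive_unique, Hd).
    apply (is_derive_RInt_param (fun y u => RInt (fun t => f t u) a y)).
    - apply filter_forall. intros y u _. eexists. apply Hd.
    - intros u _. apply (continuity_2d_pt_ext f).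
      + intros p q. symmetry. apply is_derive_unique, Hd.
      + apply Hf.
    - apply filter_forall. intros y. apply HexP'. }
  apply is_RInt_unique.
  replace (RInt (fun u => RInt (fun t => f t u) a b) c d)
    with (minus (RInt (fun u => RInt (fun t => f t u) a b) c d)
                (RInt (fun u => RInt (fun t => f t u) a a) c d)).
  - apply (is_RInt_derive (fun y => RInt (fun u => RInt (fun t => f t u) a y) c d)).
    + intros x _. apply HD.
    + intros x _. apply continuous_RInt_param; [exact Hcd | intros; apply Hf |].
      apply filter_forall. exact Hex1.
  - rewrite (RInt_ext (fun u => RInt (fun t => f t u) a a) (fun _ => 0)).
    + rewrite RInt_const. unfold minus, plus, opp, scal; simpl. unfold mult; simpl. ring.
    + intros u _. apply (RInt_point a (fun t => f t u)).
Qed.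

(** * The integral of ln |1 + r e^(i th)|^2 *)

Lemma continuity_pt_ln (x : R) : 0 < x -> continuity_pt ln x.
Proof.
  intros Hx. apply derivable_continuous_pt. exists (/ x). now apply derivable_pt_lim_ln.
Qed.

Ltac continuity_2d :=
  repeat match goal with
  | |- continuity_2d_pt (fun u v => u) _ _ => apply continuity_2d_pt_id1
  | |- continuity_2d_pt (fun u v => v) _ _ => apply continuity_2d_pt_id2
  | |- continuity_2d_pt (fun u v => ?c) _ _ => apply continuity_2d_pt_const
  | |- continuity_2d_pt (fun u v => _ + _) _ _ => apply continuity_2d_pt_plus
  | |- continuity_2d_pt (fun u v => _ - _) _ _ => apply continuity_2d_pt_minus
  | |- continuity_2d_pt (fun u v => _ * _) _ _ => apply continuity_2d_pt_mult
  | |- continuity_2d_pt (fun u v => - _) _ _ => apply continuity_2d_pt_opp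
  | |- continuity_2d_pt (fun u v => / _) _ _ => apply continuity_2d_pt_inv
  | |- continuity_2d_pt (fun u v => cos _) _ _ =>
      apply (continuity_1d_2d_pt_comp cos); [apply continuity_cos|]
  | |- continuity_2d_pt (fun u v => ln _) _ _ =>
      apply (continuity_1d_2d_pt_comp ln); [apply continuity_pt_ln|]
  end.

(** The quadratic equals [(1 + y c)^2 + y^2 (1 - c^2)], which serves [y >= 0 > c], and
    [(1 + y)^2 - 2 y (1 - c)], which serves [y < 0]. The parameter [k] lets one statement cover
    [al = PI] with [r < 1] ([k = 1]), [al = PI / 2] with any [r >= 0] ([k = 0]), and [al = 2 PI / 3]
    with [r = 1] ([k = 1 / 2]). *)
Lemma quad_cos_pos (k y c : R) :
  -1 < y -> y * k < 1 -> - k <= c -> -1 <= c <= 1 -> 0 < 1 + 2 * y * c + y * y.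
Proof.
  intros Hy Hk Hkc Hc. destruct (Rle_dec 0 y) as [H|H].
  - destruct (Rle_dec 0 c) as [Hc0|Hc0]; [nra|].
    assert (0 < 1 + y * c) by nra.
    assert (0 < (1 + y * c) * (1 + y * c)) by nra.
    assert (0 <= y * y * (1 - c * c)) by (apply Rmult_le_pos; nra). lra.
  - assert (0 < (1 + y) * (1 + y)) by nra.
    assert (0 <= - y * (1 - c)) by nra. lra.
Qed.

Lemma log_quad_continuity (k y th : R) :
  -1 < y -> y * k < 1 -> - k <= cos th ->
  continuity_2d_pt (fun y th => ln (1 + 2 * y * cos th + y * y)) y th /\
  continuity_2d_pt
    (fun y th => (2 * cos th + 2 * y) * / (1 + 2 * y * cos th + y * y)) y th.
Proof.
  intros Hy Hyk Hth.
  assert (Hp : 0 < 1 + 2 * y * cos th + y * y)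
    by (apply (quad_cos_pos k); auto using COS_bound).
  split; continuity_2d; try (apply Rgt_not_eq); apply Hp.
Qed.

Lemma log_quad_locally (k y : R) :
  -1 < y -> y * k < 1 -> locally y (fun z => -1 < z /\ z * k < 1).
Proof.
  intros Hy Hyk. apply filter_and.
  - now apply (open_gt (-1)).
  - apply (open_comp (fun z => z * k) (fun z => z < 1)).
    + intros z _. apply (continuity_pt_filterlim (fun z => z * k)). reg.
    + apply open_lt.
    + exact Hyk.
Qed.

Lemma log_quad_ex_RInt (al k y : R) :
  0 <= al -> (forall th, 0 <= th <= al -> - k <= cos th) ->
  -1 < y -> y * k < 1 ->
  ex_RInt (fun th => ln (1 + 2 * y * cos th + y * y)) 0 al /\
  ex_RInt (fun th => (2 * cos th + 2 * y) * / (1 + 2 * y * cos th + y * y)) 0 al.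
Proof.
  intros Hal Hk Hy Hyk.
  split; apply ex_RInt_continuous_le; try exact Hal; intros th Hth;
    destruct (log_quad_continuity k y th Hy Hyk (Hk th Hth)) as [H1 H2].
  - exact (continuity_2d_pt_slice _ _ _ H1).
  - exact (continuity_2d_pt_slice _ _ _ H2).
Qed.

Lemma is_derive_RInt_log_quad (al k y : R) :
  0 <= al -> (forall th, 0 <= th <= al -> - k <= cos th) ->
  -1 < y -> y * k < 1 ->
  is_derive (fun y => RInt (fun th => ln (1 + 2 * y * cos th + y * y)) 0 al) y
    (RInt (fun th => (2 * cos th + 2 * y) * / (1 + 2 * y * cos th + y * y)) 0 al).
Proof.
  intros Hal Hk Hy Hyk.
  assert (HD : forall z th, -1 < z -> z * k < 1 -> 0 <= th <= al ->
    is_derive (fun z => ln (1 + 2 * z * cos th + z * z)) z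
      ((2 * cos th + 2 * z) * / (1 + 2 * z * cos th + z * z))).
  { intros z th Hz Hzk Hth.
    assert (0 < 1 + 2 * z * cos th + z * z)
      by (apply (quad_cos_pos k); auto using COS_bound).
    auto_derive; [assumption | field; lra]. }
  assert (Hloc := log_quad_locally k y Hy Hyk).
  replace (RInt (fun th => (2 * cos th + 2 * y) * / (1 + 2 * y * cos th + y * y)) 0 al)
    with (RInt (fun th => Derive (fun z => ln (1 + 2 * z * cos th + z * z)) y) 0 al).
  2:{ apply RInt_ext. rewrite Rmin_left, Rmax_right by exact Hal. intros th Hth.
      apply is_derive_unique, HD; lra. }
  apply (is_derive_RInt_param (fun y th => ln (1 + 2 * y * cos th + y * y))).
  - revert Hloc. apply filter_imp. intros z [Hz Hzk] th.
    rewrite Rmin_left, Rmax_right by exact Hal.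
    intros Hth. eexists. now apply HD.
  - rewrite Rmin_left, Rmax_right by exact Hal. intros th Hth.
    destruct (log_quad_continuity k y th Hy Hyk (Hk th Hth)) as [_ H2].
    (* [Derive] agrees with the closed form where the argument of [ln] is positive; continuity of
       that argument provides a whole neighbourhood of such points. *)
    revert H2. apply continuity_2d_pt_ext_loc.
    assert (Hp : 0 < 1 + 2 * y * cos th + y * y)
      by (apply (quad_cos_pos k); auto using COS_bound).
    assert (Hc : continuity_2d_pt (fun y th => 1 + 2 * y * cos th + y * y) y th)
      by continuity_2d.
    destruct (Hc (mkposreal _ Hp)) as [d Hd]. exists d. intros u v Hu Hv.
    specialize (Hd u v Hu Hv). simpl in Hd. apply Rabs_def2 in Hd.
    symmetry. apply is_derive_unique. auto_derive; [lra | field; lra].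
  - revert Hloc. apply filter_imp. intros z [Hz Hzk].
    now apply (log_quad_ex_RInt al k z).
Qed.

(* The inner integral of the derivative in [y] has the primitive
   [Im Log (1 + y e^(i th)) / y]; at [y = s r] this is the arctangent [A] below. *)
Lemma is_RInt_log_quad (al k r : R) :
  0 <= al -> (forall th, 0 <= th <= al -> - k <= cos th) ->
  0 <= r -> r * k < 1 ->
  is_RInt (fun s => 2 * (atan (s * (r * sin al) / (1 + s * (r * cos al))) / s)) 0 1
    (RInt (fun th => ln (1 + 2 * r * cos th + r * r)) 0 al).
Proof.
  intros Hal Hk Hr Hrk.
  set (M := fun y => RInt (fun th => ln (1 + 2 * y * cos th + y * y)) 0 al).
  set (Q := fun y =>
    RInt (fun th => (2 * cos th + 2 * y) * / (1 + 2 * y * cos th + y * y)) 0 al).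
  assert (Hs : forall s, 0 <= s <= 1 -> -1 < s * r /\ s * r * k < 1).
  { intros s Hs. split; [nra|]. destruct (Rle_dec 0 (r * k)); nra. }
  (* [r * Q (s * r)] is the derivative of [M (s * r)] in [s], and [M 0 = 0]. The integrands have to
     agree only for [0 < s < 1], so the division by [s] is harmless. *)
  apply (is_RInt_ext (fun s => r * Q (s * r))).
  - rewrite Rmin_left, Rmax_right by lra. intros s Hs01.
    assert (Hs01' : 0 <= s <= 1) by lra.
    destruct (Hs s Hs01') as [H1 H2].
    unfold Q. transitivity (RInt (fun th => scal r ((2 * cos th + 2 * (s * r)) *
      / (1 + 2 * (s * r) * cos th + (s * r) * (s * r)))) 0 al).
    { symmetry. apply (@RInt_scal R_CompleteNormedModule).
      now apply (log_quad_ex_RInt al k). }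
    apply is_RInt_unique.
    set (A := fun th => 2 * (atan (s * (r * sin th) / (1 + s * (r * cos th))) / s)).
    change (2 * (atan (s * (r * sin al) / (1 + s * (r * cos al))) / s)) with (A al).
    replace (A al) with (minus (A al) (A 0)).
    2:{ unfold A. rewrite sin_0.
        replace (s * (r * 0) / _) with 0 by (unfold Rdiv; ring).
        rewrite atan_0. unfold minus, plus, opp; simpl. field. lra. }
    assert (Hpos : forall th, Rmin 0 al <= th <= Rmax 0 al ->
      0 < 1 + s * (r * cos th) /\
      0 < 1 + 2 * (s * r) * cos th + s * r * (s * r)).
    { rewrite Rmin_left, Rmax_right by exact Hal. intros th Hth. split.
      - specialize (Hk th Hth). assert (0 <= s * r) by nra. nra.
      - apply (quad_cos_pos k); auto using COS_bound. }
    apply (is_RInt_derive A).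
    + intros th Hth. destruct (Hpos th Hth) as [Hp1 Hp2].
      unfold A. auto_derive; [lra|].
      assert (Hsc := sin2_cos2 th). unfold Rsqr in Hsc.
      unfold scal; simpl; unfold mult; simpl.
      set (c := cos th) in *. set (d := sin th) in *.
      assert (Hd : d * d = 1 - c * c) by lra.
      assert (HW : (1 + s * (r * c)) * (1 + s * (r * c)) + (s * r) * (s * r) * (d * d)
                   = 1 + 2 * (s * r) * c + s * r * (s * r)) by (rewrite Hd; ring).
      (* The squared sine stays as [d * d], so that [field] checks the derivative of the arctangent
         with [c] and [d] independent; only afterwards does [d * d = 1 - c * c] enter. *)
      transitivity (2 * (s * r * c * (1 + s * (r * c)) + (s * r) * (s * r) * (d * d))
        / ((1 + s * (r * c)) * (1 + s * (r * c)) + (s * r) * (s * r) * (d * d)) / s).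
      * field. repeat split; lra.
      * rewrite HW, Hd. field. lra.
    + intros th Hth. destruct (Hpos th Hth) as [Hp1 Hp2].
      apply (ex_derive_continuous (V := R_NormedModule)).
      unfold scal; simpl; unfold mult; simpl. auto_derive. lra.
  - replace (RInt (fun th => ln (1 + 2 * r * cos th + r * r)) 0 al)
      with (minus (M (1 * r)) (M (0 * r))).
    + apply (is_RInt_derive (fun s => M (s * r)) (fun s => r * Q (s * r)));
      rewrite Rmin_left, Rmax_right by lra; intros s Hs01; destruct (Hs s Hs01).
      * apply (is_derive_comp M (fun s => s * r)).
        -- now apply (is_derive_RInt_log_quad al k).
        -- auto_derive; [trivial | ring].
      * apply (continuous_scal (K := R_AbsRing) (V := R_NormedModule) (fun _ => r)).
        -- apply continuous_const.
        -- apply (continuous_comp (fun s => s * r) Q).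
           ++ apply (ex_derive_continuous (V := R_NormedModule)). auto_derive. trivial.
           ++ apply (continuous_RInt_param
                (fun y th => (2 * cos th + 2 * y) * / (1 + 2 * y * cos th + y * y)));
                [exact Hal | |].
              ** intros th Hth. now apply (log_quad_continuity k); auto.
              ** generalize (log_quad_locally k (s * r) H H0). apply filter_imp.
                 intros z [Hz Hzk]. now apply (log_quad_ex_RInt al k z).
    + unfold M. rewrite Rmult_1_l, Rmult_0_l.
      rewrite (RInt_ext (fun th => ln (1 + 2 * 0 * cos th + 0 * 0)) (fun _ => 0)).
      * rewrite RInt_const. unfold minus, plus, opp, scal; simpl. unfold mult; simpl.
        now rewrite Rmult_0_r, Ropp_0, Rplus_0_r.
      * intros th _. replace (1 + _ + _) with 1 by ring. apply ln_1.
Qed.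

(** * Jensen's formula and the modulus of pC1 on the torus *)

(** Bridge from Coquelicot's integral, in which the proof works, to the Riemann integral of the
    definitions. *)
Lemma Defs_is_RInt (f : R -> R) (a b v : R) : is_RInt f a b v -> Defs.is_RInt f a b v.
Proof.
  intros H. exists (ex_RInt_Reals_0 f a b (ex_intro _ v H)).
  rewrite <- RInt_Reals. now apply is_RInt_unique.
Qed.

(** Existence makes the value picked by [epsilon] an integral of [f], and that value is unique. *)
Lemma Defs_RInt (f : R -> R) (a b v : R) : is_RInt f a b v -> Defs.RInt f a b = v.
Proof.
  intros H.
  assert (Hs : Defs.is_RInt f a b (Defs.RInt f a b)).
  { apply (ClassicalEpsilon.epsilon_spec (inhabits 0) (fun w => Defs.is_RInt f a b w)).
    exists v. now apply Defs_is_RInt. }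
  destruct Hs as [pr Hpr].
  rewrite <- Hpr, <- RInt_Reals. now apply is_RInt_unique.
Qed.

(** The substitution [t -> 2 PI - t] carries [[PI, 2 PI]] to [[0, PI]] and fixes the cosine, so each
    half contributes [v]. *)
Lemma is_RInt_cos_period (g : R -> R) (v : R) :
  is_RInt (fun t => g (cos t)) 0 PI v -> is_RInt (fun t => g (cos t)) 0 (2 * PI) (2 * v).
Proof.
  intros H. replace (2 * v) with (plus v v) by (unfold plus; simpl; ring).
  apply (@is_RInt_Chasles R_NormedModule _ 0 PI (2 * PI) v v); [exact H|].
  apply (is_RInt_ext (fun t => opp (scal (-1) (g (cos (-1 * t + 2 * PI)))))).
  { intros t _. unfold opp, scal; simpl; unfold mult; simpl.
    replace (cos (-1 * t + 2 * PI)) with (cos t); [ring|].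
    rewrite <- (cos_neg t), <- (cos_period (- t) 1). f_equal. simpl. ring. }
  replace v with (opp (opp v)) by apply opp_opp.
  apply (@is_RInt_opp R_NormedModule).
  apply (@is_RInt_comp_lin R_NormedModule (fun t => g (cos t))).
  apply (@is_RInt_swap R_NormedModule).
  replace (-1 * PI + 2 * PI) with PI by ring.
  now replace (-1 * (2 * PI) + 2 * PI) with 0 by ring.
Qed.

(** Jensen's formula for [1 + r z], which has no zero in the closed unit disc. At [al = PI] the sine
    vanishes and with it the arctangent integrand. *)
Lemma RInt_log_quad_PI (r : R) :
  0 <= r < 1 -> is_RInt (fun t => ln (1 + 2 * r * cos t + r * r)) 0 PI 0.
Proof.
  intros Hr. assert (HPI := PI_RGT_0).
  assert (Hc : forall th, 0 <= th <= PI -> - 1 <= cos th) by (intros; apply COS_bound).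
  replace 0 with (RInt (fun t => ln (1 + 2 * r * cos t + r * r)) 0 PI) at 2.
  { apply (@RInt_correct R_CompleteNormedModule).
    apply (log_quad_ex_RInt PI 1 r); try assumption; lra. }
  assert (H : is_RInt (fun s => 2 * (atan (s * (r * sin PI) / (1 + s * (r * cos PI))) / s)) 0 1
    (RInt (fun th => ln (1 + 2 * r * cos th + r * r)) 0 PI)).
  { apply (is_RInt_log_quad PI 1 r); try assumption; lra. }
  apply (@is_RInt_unique R_CompleteNormedModule) in H. rewrite <- H.
  rewrite (RInt_ext _ (fun _ => 0)).
  - rewrite RInt_const. unfold scal; simpl; unfold mult; simpl. ring.
  - intros s _. rewrite sin_PI.
    replace (s * (r * 0) / _) with 0 by (unfold Rdiv; ring).
    rewrite atan_0. change (2 * (0 / s) = 0 :> R). unfold Rdiv. ring.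
Qed.

(* With [r = (p - s) / (p + s)] the integrand is
   [ln (((p + s) / 2)^2 |1 + r e^(it)|^2)]. *)
Lemma is_RInt_jensen (p s : R) :
  0 < s <= p ->
  is_RInt (fun t => ln ((p * p + s * s) / 2 + (p * p - s * s) / 2 * cos t)) 0 (2 * PI)
    (4 * PI * ln ((p + s) / 2)).
Proof.
  intros Hs.
  apply (is_RInt_ext (fun t => plus (2 * ln ((p + s) / 2))
    (ln (1 + 2 * ((p - s) / (p + s)) * cos t + (p - s) / (p + s) * ((p - s) / (p + s)))))).
  - intros t _. unfold plus; simpl.
    assert (Hr : 0 <= (p - s) / (p + s)) by (apply Rdiv_le_0_compat; lra).
    assert (Hr1 : (p - s) / (p + s) < 1)
      by (apply Rmult_lt_reg_r with (p + s); [lra|]; field_simplify; lra).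
    assert (0 < 1 + 2 * ((p - s) / (p + s)) * cos t + (p - s) / (p + s) * ((p - s) / (p + s))).
    { assert (Hc := COS_bound t). apply (quad_cos_pos 1); lra. }
    replace (2 * ln ((p + s) / 2)) with (ln ((p + s) / 2) + ln ((p + s) / 2)) by ring.
    rewrite <- !ln_mult by (try assumption; try apply Rmult_lt_0_compat; lra).
    f_equal. field. lra.
  - replace (4 * PI * ln ((p + s) / 2))
      with (plus (scal (2 * PI - 0) (2 * ln ((p + s) / 2))) (2 * 0))
      by (unfold plus, scal; simpl; unfold mult; simpl; ring).
    apply (@is_RInt_plus R_NormedModule); [apply (@is_RInt_const R_NormedModule)|].
    apply (is_RInt_cos_period (fun c => ln (1 + 2 * ((p - s) / (p + s)) * c
      + (p - s) / (p + s) * ((p - s) / (p + s))))).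
    apply RInt_log_quad_PI. split; [apply Rdiv_le_0_compat; lra|].
    apply Rmult_lt_reg_r with (p + s); [lra|]; field_simplify; lra.
Qed.

Definition torus_modulus (t u : R) : R := 20 + 4 * cos u + (12 - 4 * cos u) * cos t.

(** Dividing [pC1] by [z w] leaves [(w + 1/w)(z - 2 + 1/z) - (6 z + 20 + 6/z)], which on the torus
    is the real number [- torus_modulus t u]. *)
Lemma Cnorm2_pC1 (t u : R) : Cnorm2 (pC1 (Cexpi t) (Cexpi u))
  = torus_modulus t u * torus_modulus t u.
Proof.
  unfold torus_modulus, pC1, Cnorm2, Csub, Cmul, Cadd, Cof, Cexpi; simpl.
  assert (Ht := sin2_cos2 t). assert (Hu := sin2_cos2 u). unfold Rsqr in *.
  set (a := cos t) in *. set (b := sin t) in *.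
  set (c := cos u) in *. set (d := sin u) in *.
  nsatz.
Qed.

(** The coefficient [12 - 4 cos u] is positive, so the minimum in [t] is attained at [cos t = -1];
    likewise the maximum 32 at [cos t = 1]. *)
Lemma torus_modulus_ge (t u : R) : 8 + 8 * cos u <= torus_modulus t u.
Proof.
  unfold torus_modulus. assert (Ht := COS_bound t). assert (Hu := COS_bound u). nra.
Qed.

Lemma torus_modulus_le (t u : R) : torus_modulus t u <= 32.
Proof.
  unfold torus_modulus. assert (Ht := COS_bound t). assert (Hu := COS_bound u). nra.
Qed.

(** Truncation commutes with squaring of nonnegative numbers, and the factor 1/2 in [log_trunc]
    undoes the square. *)
Lemma log_trunc_pC1 (N : nat) (t u : R) :
  log_trunc pC1 N t u = ln (Rmax (torus_modulus t u) (exp (- INR N))).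
Proof.
  unfold log_trunc. rewrite Cnorm2_pC1.
  assert (He := exp_pos (- INR N)).
  assert (Hq : 0 <= torus_modulus t u).
  { assert (H1 := torus_modulus_ge t u). assert (H2 := COS_bound u). lra. }
  set (m := Rmax (torus_modulus t u) (exp (- INR N))).
  assert (Hm : 0 < m) by (unfold m; eapply Rlt_le_trans; [exact He | apply Rmax_r]).
  replace (Rmax (torus_modulus t u * torus_modulus t u) (exp (-2 * INR N))) with (m * m).
  - rewrite ln_mult by exact Hm. field.
  - replace (exp (-2 * INR N)) with (exp (- INR N) * exp (- INR N))
      by (rewrite <- exp_plus; f_equal; ring).
    unfold m, Rmax.
    destruct (Rle_dec (torus_modulus t u) (exp (- INR N))),
      (Rle_dec (torus_modulus t u * torus_modulus t u)
      (exp (- INR N) * exp (- INR N))); nra.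
Qed.

Lemma continuity_pt_Rmax (e x : R) : continuity_pt (fun y => Rmax y e) x.
Proof.
  apply continuity_pt_locally. intros eps. exists eps. intros y Hy.
  change (Rabs (y - x) < eps) in Hy.
  eapply Rle_lt_trans; [|exact Hy].
  unfold Rmax. destruct (Rle_dec y e), (Rle_dec x e); unfold Rabs;
    repeat destruct Rcase_abs; lra.
Qed.

Lemma log_max_continuity (e t u : R) :
  0 < e -> continuity_2d_pt (fun t u => ln (Rmax (torus_modulus t u) e)) t u.
Proof.
  intros He. apply (continuity_1d_2d_pt_comp ln).
  - apply continuity_pt_ln. eapply Rlt_le_trans; [exact He | apply Rmax_r].
  - apply (continuity_1d_2d_pt_comp (fun y => Rmax y e)).
    + apply continuity_pt_Rmax.
    + unfold torus_modulus. continuity_2d.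
Qed.

(** * Convergence of the truncated integrals *)

Definition trunc_slice (e u : R) : R := RInt (fun t => ln (Rmax (torus_modulus t u) e)) 0 (2 * PI).

(** Jensen's value of the untruncated [t]-integral. The formula is continuous also at [u = PI],
    where the integrand is singular. *)
Definition log_slice (u : R) : R := 4 * PI * ln (2 * sqrt 2 + sqrt (2 + 2 * cos u)).

Lemma log_max_ex_RInt (e u : R) :
  0 < e -> ex_RInt (fun t => ln (Rmax (torus_modulus t u) e)) 0 (2 * PI).
Proof.
  intros He. assert (HPI := PI_RGT_0). apply ex_RInt_continuous_le; [lra|]. intros t _.
  apply (continuity_2d_pt_slice (fun u t => ln (Rmax (torus_modulus t u) e))).
  apply (continuity_2d_pt_swap (fun t u => ln (Rmax (torus_modulus t u) e))).
  now apply log_max_continuity.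
Qed.

Lemma trunc_slice_continuous (e u : R) : 0 < e -> continuous (trunc_slice e) u.
Proof.
  intros He. assert (HPI := PI_RGT_0).
  apply (continuous_RInt_param (fun u t => ln (Rmax (torus_modulus t u) e))); [lra | |].
  - intros t _. apply (continuity_2d_pt_swap (fun t u => ln (Rmax (torus_modulus t u) e))).
    now apply log_max_continuity.
  - apply filter_forall. intros v. now apply log_max_ex_RInt.
Qed.

Lemma sqrt2_gt : 14142 / 10000 < sqrt 2.
Proof.
  rewrite <- (sqrt_square (14142 / 10000)) by lra. apply sqrt_lt_1; lra.
Qed.

Lemma log_slice_continuous (u : R) : continuous log_slice u.
Proof.
  apply continuity_pt_filterlim. unfold log_slice.
  assert (H2 := sqrt2_gt). assert (Hs := sqrt_pos (2 + 2 * cos u)).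
  assert (Hc := COS_bound u).
  apply continuity_pt_mult; [reg|].
  apply (continuity_pt_comp (fun u => 2 * sqrt 2 + sqrt (2 + 2 * cos u)) ln).
  - apply continuity_pt_plus; [reg|].
    apply (continuity_pt_comp (fun u => 2 + 2 * cos u) sqrt); [reg|].
    apply continuity_pt_sqrt. lra.
  - apply continuity_pt_ln. lra.
Qed.

(** Jensen's formula with [p^2 = 32] and [s^2 = 8 + 8 cos u], the maximum and minimum of the modulus
    in [t]. *)
Lemma is_RInt_log_torus_modulus (u : R) :
  0 < 1 + cos u -> is_RInt (fun t => ln (torus_modulus t u)) 0 (2 * PI) (log_slice u).
Proof.
  intros Hu. assert (Hc := COS_bound u).
  assert (H2 : sqrt 2 * sqrt 2 = 2) by (apply sqrt_sqrt; lra).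
  assert (H2p := sqrt2_gt).
  assert (Hs : sqrt (2 + 2 * cos u) * sqrt (2 + 2 * cos u) = 2 + 2 * cos u)
    by (apply sqrt_sqrt; lra).
  assert (Hsp : 0 < sqrt (2 + 2 * cos u)) by (apply sqrt_lt_R0; lra).
  set (p := sqrt 2) in *. set (s := sqrt (2 + 2 * cos u)) in *.
  assert (Hle : s <= 2 * p) by (apply Rsqr_incr_0_var; unfold Rsqr; nra).
  unfold log_slice. fold p s.
  replace (2 * p + s) with ((4 * p + 2 * s) / 2) by field.
  apply (is_RInt_ext (fun t => ln ((4 * p * (4 * p) + 2 * s * (2 * s)) / 2
    + (4 * p * (4 * p) - 2 * s * (2 * s)) / 2 * cos t))).
  - intros t _. f_equal. unfold torus_modulus.
    replace (4 * p * (4 * p)) with 32 by lra.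
    replace (2 * s * (2 * s)) with (8 + 8 * cos u) by lra. field.
  - apply is_RInt_jensen. lra.
Qed.

Lemma log_slice_le_trunc (e u : R) :
  0 < e -> 0 < 1 + cos u -> log_slice u <= trunc_slice e u.
Proof.
  intros He Hu. assert (HPI := PI_RGT_0). assert (H := is_RInt_log_torus_modulus u Hu).
  rewrite <- (is_RInt_unique _ _ _ _ H). apply RInt_le; [lra | | |].
  - eexists; exact H.
  - now apply log_max_ex_RInt.
  - intros t _. apply ln_le; [|apply Rmax_l]. assert (Hq := torus_modulus_ge t u). lra.
Qed.

Lemma trunc_slice_eq (e u : R) :
  0 < e <= 8 + 8 * cos u -> trunc_slice e u = log_slice u.
Proof.
  intros He. rewrite <- (is_RInt_unique _ _ _ _ (is_RInt_log_torus_modulus u ltac:(lra))).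
  apply RInt_ext. intros t _. rewrite Rmax_left; [reflexivity|].
  assert (Hq := torus_modulus_ge t u). lra.
Qed.

(** A crude bound, uniform in [u]: the modulus is at most 32, while [log_slice u] is at least
    [2 PI ln 8] because [(2 sqrt 2)^2 = 8]. *)
Lemma trunc_slice_le (e u : R) :
  0 < e <= 1 -> trunc_slice e u <= log_slice u + 2 * PI * ln 4.
Proof.
  intros He. assert (HPI := PI_RGT_0).
  assert (H1 : trunc_slice e u <= 2 * PI * ln 32).
  { replace (2 * PI * ln 32) with (RInt (fun _ => ln 32) 0 (2 * PI)).
    - apply RInt_le; [lra | apply log_max_ex_RInt; lra | apply ex_RInt_const |].
      intros t _. apply ln_le.
      + eapply Rlt_le_trans; [apply He | apply Rmax_r].
      + apply Rmax_lub; [apply torus_modulus_le | lra].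
    - rewrite RInt_const. unfold scal; simpl; unfold mult; simpl. ring. }
  assert (H2 : 2 * PI * ln 8 <= log_slice u).
  { unfold log_slice. replace (4 * PI) with (2 * PI * 2) by ring.
    rewrite (Rmult_assoc _ 2). apply Rmult_le_compat_l; [lra|].
    assert (Hp := sqrt2_gt).
    assert (Hpp : sqrt 2 * sqrt 2 = 2) by (apply sqrt_sqrt; lra).
    assert (Hs := sqrt_pos (2 + 2 * cos u)).
    set (x := 2 * sqrt 2 + sqrt (2 + 2 * cos u)).
    assert (Hx : 2 * sqrt 2 <= x) by (unfold x; lra).
    replace (2 * ln x) with (ln x + ln x) by ring.
    rewrite <- ln_mult by lra. apply ln_le; nra. }
  replace (ln 4) with (ln 32 - ln 8); [lra|].
  replace 32 with (4 * 8) by ring. rewrite ln_mult by lra. ring.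
Qed.

Lemma cos_far_from_PI (d u : R) :
  0 <= d <= PI -> 0 <= u <= 2 * PI -> d <= Rabs (u - PI) -> - cos d <= cos u.
Proof.
  intros Hd Hu Hdu.
  replace (cos u) with (- cos (Rabs (u - PI))).
  - apply Ropp_le_contravar. apply cos_decr_1; try lra.
    apply Rabs_le. lra.
  - assert (H : cos (u - PI) = - cos u) by (rewrite cos_minus, cos_PI, sin_PI; ring).
    unfold Rabs. destruct Rcase_abs; [rewrite cos_neg|]; lra.
Qed.

Lemma sum_sqr_pos (d x : R) : 0 < d -> 0 < d * d + x * x.
Proof. intros Hd. assert (H := Rle_0_sqr x). unfold Rsqr in H. nra. Qed.

(* An integrable bump that is at least 1 on [|u - PI| < d] and has mass [O(d)]: it dominates
   the truncation error near the zero of [pC1]. *)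
Lemma is_RInt_cauchy_kernel (K d : R) :
  0 < d ->
  is_RInt (fun u => K * (2 * d * d / (d * d + (u - PI) * (u - PI)))) 0 (2 * PI)
    (K * (4 * d * atan (PI / d))).
Proof.
  intros Hd.
  set (A := fun u => K * (2 * d * atan ((u - PI) / d))).
  replace (K * (4 * d * atan (PI / d))) with (minus (A (2 * PI)) (A 0)).
  - apply (is_RInt_derive A); intros u _;
      assert (Hp := sum_sqr_pos d (u - PI) Hd).
    + unfold A. auto_derive; [lra|]. field. split; [|lra]. nra.
    + apply (ex_derive_continuous (V := R_NormedModule)). auto_derive. lra.
  - unfold A, minus, plus, opp; simpl.
    replace (2 * PI - PI) with PI by ring.
    replace ((0 - PI) / d) with (- (PI / d)) by (field; lra).
    rewrite atan_opp. ring.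
Qed.

(** At distance at least [d] from [PI] the truncation is inactive; closer to [PI] the bump is at
    least 1 and absorbs the uniform error. *)
Lemma trunc_slice_le_bump (e d u : R) :
  0 < d <= PI -> 0 <= u <= 2 * PI -> 0 < e <= 1 -> e <= 8 - 8 * cos d ->
  trunc_slice e u
  <= log_slice u + 2 * PI * ln 4 * (2 * d * d / (d * d + (u - PI) * (u - PI))).
Proof.
  intros Hd Hu He Hed. assert (HPI := PI_RGT_0).
  assert (Hln : 0 < ln 4) by (rewrite <- ln_1; apply ln_increasing; lra).
  assert (HK : 0 < 2 * PI * ln 4) by (apply Rmult_lt_0_compat; lra).
  assert (Hp := sum_sqr_pos d (u - PI) (proj1 Hd)).
  destruct (Rle_dec d (Rabs (u - PI))) as [H|H].
  - assert (Hc := cos_far_from_PI d u ltac:(lra) Hu H).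
    rewrite trunc_slice_eq by lra.
    assert (0 <= 2 * d * d / (d * d + (u - PI) * (u - PI)))
      by (apply Rdiv_le_0_compat; nra).
    nra.
  - assert (Hb : 1 <= 2 * d * d / (d * d + (u - PI) * (u - PI))).
    { apply Rmult_le_reg_r with (d * d + (u - PI) * (u - PI)); [exact Hp|].
      field_simplify; [|lra].
      assert (H' : Rabs (u - PI) < d) by lra. apply Rabs_def2 in H'. nra. }
    assert (Ht := trunc_slice_le e u He). nra.
Qed.

(** The pointwise comparison assumes [1 + cos u > 0]. Splitting at [PI] turns the exceptional point
    into an endpoint, which [RInt_le] ignores. *)
Lemma RInt_log_slice_le_trunc (e : R) :
  0 < e -> RInt log_slice 0 (2 * PI) <= RInt (trunc_slice e) 0 (2 * PI).
Proof.
  intros He. assert (HPI := PI_RGT_0).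
  assert (HG : forall a b, ex_RInt log_slice a b).
  { intros a b. apply (@ex_RInt_continuous R_CompleteNormedModule).
    intros u _. apply log_slice_continuous. }
  assert (HT : forall a b, ex_RInt (trunc_slice e) a b).
  { intros a b. apply (@ex_RInt_continuous R_CompleteNormedModule).
    intros u _. now apply trunc_slice_continuous. }
  rewrite <- (RInt_Chasles log_slice 0 PI (2 * PI)), <- (RInt_Chasles (trunc_slice e) 0 PI (2 * PI))
    by auto.
  apply Rplus_le_compat; apply RInt_le; auto; try lra; intros u Hu;
    apply log_slice_le_trunc; try exact He.
  - assert (cos PI < cos u) by (apply cos_decreasing_1; lra). rewrite cos_PI in *. lra.
  - assert (cos PI < cos u) by (apply cos_increasing_1; lra). rewrite cos_PI in *. lra.
Qed.

Lemma RInt_trunc_slice_cv :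
  Un_cv (fun N => RInt (trunc_slice (exp (- INR N))) 0 (2 * PI)) (RInt log_slice 0 (2 * PI)).
Proof.
  intros eta Heta. assert (HPI := PI_RGT_0).
  assert (Hln : 0 < ln 4) by (rewrite <- ln_1; apply ln_increasing; lra).
  set (K := 2 * PI * ln 4).
  assert (HK : 0 < K) by (apply Rmult_lt_0_compat; lra).
  (* With this [d] the mass of the bump, less than [2 PI K d], stays below [eta]; the minimum with
     [PI] keeps [d] where the cosine decreases. *)
  set (d := Rmin PI (eta / (4 * PI * K))).
  assert (HKp : 0 < 4 * PI * K) by (apply Rmult_lt_0_compat; lra).
  assert (Hd : 0 < d <= PI).
  { split; [apply Rmin_pos; [lra | now apply Rdiv_lt_0_compat] | apply Rmin_l]. }
  assert (HdK : d * (4 * PI * K) <= eta).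
  { apply Rle_trans with (eta / (4 * PI * K) * (4 * PI * K)).
    - apply Rmult_le_compat_r; [lra | apply Rmin_r].
    - right. field. repeat split; apply Rgt_not_eq; assumption. }
  assert (Hcd : 0 < 8 - 8 * cos d).
  { assert (cos d < cos 0) by (apply cos_decreasing_1; lra). rewrite cos_0 in *. lra. }
  (* From [N0] on, [exp (- INR N)] lies below [8 - 8 cos d], the least value of [8 + 8 cos u] at
     distance at least [d] from [PI]. *)
  destruct (INR_unbounded (- ln (8 - 8 * cos d))) as [N0 HN0].
  exists N0. intros N HN. apply le_INR in HN.
  assert (He : 0 < exp (- INR N) <= 1).
  { split; [apply exp_pos|]. rewrite <- exp_0.
    destruct (Req_dec (INR N) 0) as [HN'|HN'].
    - rewrite HN', Ropp_0. lra.
    - left. apply exp_increasing. assert (H := pos_INR N). lra. }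
  assert (Hed : exp (- INR N) <= 8 - 8 * cos d).
  { left. rewrite <- (exp_ln (8 - 8 * cos d)) by exact Hcd. apply exp_increasing. lra. }
  assert (H1 := RInt_log_slice_le_trunc (exp (- INR N)) (exp_pos _)).
  assert (HG : ex_RInt log_slice 0 (2 * PI)).
  { apply ex_RInt_continuous_le; [lra|]. intros u _. apply log_slice_continuous. }
  assert (HT : ex_RInt (trunc_slice (exp (- INR N))) 0 (2 * PI)).
  { apply ex_RInt_continuous_le; [lra|]. intros u _. apply trunc_slice_continuous, exp_pos. }
  assert (HB := is_RInt_cauchy_kernel K d ltac:(lra)).
  assert (H2 : RInt (trunc_slice (exp (- INR N))) 0 (2 * PI)
    <= RInt log_slice 0 (2 * PI) + K * (4 * d * atan (PI / d))).
  { rewrite <- (is_RInt_unique _ _ _ _ HB).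
    rewrite <- (RInt_plus log_slice) by (try assumption; eexists; exact HB).
    apply RInt_le; [lra | assumption | |].
    { apply (ex_RInt_plus log_slice); [assumption | eexists; exact HB]. }
    intros u Hu. apply trunc_slice_le_bump; lra. }
  assert (Hat : atan (PI / d) < PI / 2) by apply atan_bound.
  assert (H3 : K * (4 * d * atan (PI / d)) < eta).
  { apply Rlt_le_trans with (K * (4 * d * (PI / 2))); [|nra].
    apply Rmult_lt_compat_l; [exact HK|]. apply Rmult_lt_compat_l; lra. }
  unfold Rdist. apply Rabs_def1; lra.
Qed.

Lemma is_mahler_measure_pC1 :
  is_mahler_measure pC1 (RInt log_slice 0 (2 * PI) / (4 * PI ^ 2)).
Proof.
  assert (HPI := PI_RGT_0).
  assert (HP2 : 4 * PI ^ 2 <> 0) by (apply Rgt_not_eq; nra).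
  exists (fun N => RInt (trunc_slice (exp (- INR N))) 0 (2 * PI) / (4 * PI ^ 2)). split.
  - intros N. assert (He := exp_pos (- INR N)).
    assert (Hex : forall t,
      ex_RInt (fun u => ln (Rmax (torus_modulus t u) (exp (- INR N)))) 0 (2 * PI)).
    { intros t. apply ex_RInt_continuous_le; [lra|]. intros u _.
      apply (continuity_2d_pt_slice (fun t u => ln (Rmax (torus_modulus t u) (exp (- INR N))))).
      now apply log_max_continuity. }
    exists (fun t => RInt (fun u => ln (Rmax (torus_modulus t u) (exp (- INR N)))) 0 (2 * PI)).
    split.
    + intros t. apply Defs_is_RInt.
      apply (is_RInt_ext (fun u => ln (Rmax (torus_modulus t u) (exp (- INR N))))).
      * intros u _. symmetry. apply log_trunc_pC1.
      * apply (@RInt_correct R_CompleteNormedModule), Hex.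
    + apply Defs_is_RInt.
      assert (Hdiv : forall x, 4 * PI ^ 2 * (x / (4 * PI ^ 2)) = x) by (intros x; field; lra).
      rewrite Hdiv.
      unfold trunc_slice.
      (* The definition integrates in [u] first, whereas Jensen's formula was applied in [t]. *)
      rewrite <- (RInt_swap_order (fun t u => ln (Rmax (torus_modulus t u) (exp (- INR N)))));
        [|lra|lra|intros; now apply log_max_continuity].
      apply (@RInt_correct R_CompleteNormedModule).
      apply ex_RInt_continuous_le; [lra|]. intros t _.
      apply continuous_RInt_param; [lra | intros; now apply log_max_continuity |].
      now apply filter_forall.
  - apply (CV_mult _ (fun _ => / (4 * PI ^ 2))); [apply RInt_trunc_slice_cv|].
    intros eps Heps. exists 0%nat. intros n _. unfold Rdist.
    rewrite Rminus_diag, Rabs_R0. exact Heps.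
Qed.

(** * The closed form *)

Definition quarter_log_quad (r : R) : R :=
  RInt (fun th => ln (1 + 2 * r * cos th + r * r)) 0 (PI / 2).

Lemma cos_quarter_ge_0 (th : R) : 0 <= th <= PI / 2 -> - 0 <= cos th.
Proof. intros Hth. rewrite Ropp_0. apply cos_ge_0; lra. Qed.

(** At [al = PI / 2] the arctangent simplifies, and [quarter_log_quad r / 2] is the inverse tangent
    integral, the imaginary part of [Li_2(i r)]. Here [k = 0], so [r] may exceed 1, as [1 + sqrt 2]
    does. *)
Lemma is_RInt_atan_div (r : R) :
  0 <= r -> is_RInt (fun s => atan (s * r) / s) 0 1 (quarter_log_quad r / 2).
Proof.
  intros Hr. assert (HPI := PI_RGT_0).
  assert (H := is_RInt_log_quad (PI / 2) 0 r ltac:(lra) cos_quarter_ge_0 Hr ltac:(lra)).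
  apply (is_RInt_scal (V := R_NormedModule) _ _ _ (/ 2)) in H.
  replace (quarter_log_quad r / 2) with (scal (/ 2) (quarter_log_quad r))
    by (unfold scal; simpl; unfold mult; simpl; field).
  revert H. apply is_RInt_ext. intros s _.
  rewrite sin_PI2, cos_PI2. unfold scal; simpl; unfold mult; simpl.
  replace (s * (r * 1) / (1 + s * (r * 0))) with (s * r) by field.
  set (x := atan (s * r) / s). field.
Qed.

(** The number [1 - s i y] has real part 1, hence argument [- atan (s y)]. *)
Lemma BW_imag (y : R) : 0 < y -> BW (0, y) = quarter_log_quad y / 2 - atan y * ln y.
Proof.
  intros Hy. unfold BW, ImLi2.
  rewrite (Defs_RInt _ 0 1 (opp (quarter_log_quad y / 2))).
  - unfold Cabs, Cnorm2, Carg, Csub, Cof, opp; simpl.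
    destruct (Rlt_dec 0 (1 - 0)) as [_|Hn]; [|exfalso; lra].
    replace (0 * 0 + y * y) with (y * y) by ring. rewrite sqrt_square by lra.
    replace ((0 - y) / (1 - 0)) with (- y) by field. rewrite atan_opp. ring.
  - apply (is_RInt_ext (fun s => opp (atan (s * y) / s))).
    + intros s _. unfold Carg, Csub, Cof, Cmul, opp; simpl.
      destruct (Rlt_dec 0 (1 - (s * 0 - 0 * y))) as [_|Hn]; [|exfalso; lra].
      replace ((0 - (s * y + 0 * 0)) / (1 - (s * 0 - 0 * y))) with (- (s * y)) by field.
      rewrite atan_opp. unfold Rdiv. ring.
    + apply (@is_RInt_opp R_NormedModule), is_RInt_atan_div. lra.
Qed.

(** For [b = sqrt 2 - 1] one has [(1 - b) / (1 + b) = b], so the subtraction formula gives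
    [atan 1 - atan b = atan b]. *)
Lemma atan_sqrt2_minus_1 : atan (sqrt 2 - 1) = PI / 8.
Proof.
  assert (H2 : sqrt 2 * sqrt 2 = 2) by (apply sqrt_sqrt; lra).
  assert (Hp := sqrt2_gt).
  assert (Hs : atan_sub 1 (sqrt 2 - 1) = sqrt 2 - 1).
  { unfold atan_sub. field_simplify_eq; nra. }
  assert (Hb := atan_bound (sqrt 2 - 1)).
  assert (Hb0 : 0 < atan (sqrt 2 - 1)).
  { rewrite <- atan_0. apply atan_increasing. lra. }
  assert (H := atan_sub_correct 1 (sqrt 2 - 1)).
  rewrite Hs, atan_1 in H. assert (HPI := PI_RGT_0).
  assert (PI / 4 = atan (sqrt 2 - 1) + atan (sqrt 2 - 1)) by (apply H; lra). lra.
Qed.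

Lemma inv_sqrt2_minus_1 : / (sqrt 2 - 1) = 1 + sqrt 2.
Proof.
  assert (H2 : sqrt 2 * sqrt 2 = 2) by (apply sqrt_sqrt; lra).
  assert (Hp := sqrt2_gt). field_simplify_eq; nra.
Qed.

Lemma atan_1_plus_sqrt2 : atan (1 + sqrt 2) = 3 * PI / 8.
Proof.
  assert (Hp := sqrt2_gt).
  rewrite <- inv_sqrt2_minus_1, atan_inv, atan_sqrt2_minus_1 by lra. field.
Qed.

Definition log_integral : R := RInt (fun th => ln (2 * sqrt 2 + 2 * cos th)) 0 (PI / 2).

(** Factor [1 + 2 r c + r^2 = r (r + 1/r + 2 c)]. The reciprocal roots [1 + sqrt 2] and [sqrt 2 - 1]
    thus lead to the same [log_integral]. *)
Lemma quarter_log_integral (r : R) :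
  0 < r -> r + / r = 2 * sqrt 2 -> quarter_log_quad r = log_integral + PI / 2 * ln r.
Proof.
  intros Hr Hrr. assert (HPI := PI_RGT_0). assert (Hp := sqrt2_gt).
  assert (Hex : ex_RInt (fun th => ln (2 * sqrt 2 + 2 * cos th)) 0 (PI / 2)).
  { apply ex_RInt_continuous_le; [lra|]. intros th Hth.
    assert (Hc := cos_quarter_ge_0 th Hth).
    apply (ex_derive_continuous (V := R_NormedModule)). auto_derive. lra. }
  replace (PI / 2 * ln r) with (RInt (fun _ => ln r) 0 (PI / 2))
    by (rewrite RInt_const; unfold scal; simpl; unfold mult; simpl; ring).
  unfold quarter_log_quad, log_integral.
  rewrite <- (RInt_plus (fun th => ln (2 * sqrt 2 + 2 * cos th)))
    by (assumption || apply ex_RInt_const).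
  apply RInt_ext. rewrite Rmin_left, Rmax_right by lra. intros th Hth.
  assert (Hc := cos_quarter_ge_0 th ltac:(lra)).
  unfold plus; simpl. rewrite <- ln_mult by lra. f_equal.
  rewrite <- Hrr. field. lra.
Qed.

(** On [[0, PI]] the half-angle formula gives [sqrt (2 + 2 cos u) = 2 cos (u / 2)], the cosine being
    nonnegative there; then substitute [th = u / 2]. *)
Lemma RInt_log_slice_eq : RInt log_slice 0 (2 * PI) = 16 * PI * log_integral.
Proof.
  assert (HPI := PI_RGT_0). assert (Hp := sqrt2_gt).
  apply is_RInt_unique.
  replace (16 * PI * log_integral) with (2 * (8 * PI * log_integral)) by ring.
  apply (is_RInt_cos_period (fun c => 4 * PI * ln (2 * sqrt 2 + sqrt (2 + 2 * c)))).
  apply (is_RInt_ext (fun u => scal (8 * PI)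
    (scal (/ 2) (ln (2 * sqrt 2 + 2 * cos (/ 2 * u + 0)))))).
  - rewrite Rmin_left, Rmax_right by lra. intros u Hu.
    rewrite Rplus_0_r. unfold scal; simpl; unfold mult; simpl.
    assert (Hc : 0 <= cos (/ 2 * u)) by (apply cos_ge_0; lra).
    replace (2 + 2 * cos u) with (2 * cos (/ 2 * u) * (2 * cos (/ 2 * u))).
    + rewrite sqrt_square by lra. field.
    + replace u with (2 * (/ 2 * u)) at 3 by field. rewrite cos_2a_cos. ring.
  - replace (8 * PI * log_integral) with (scal (8 * PI) log_integral) by reflexivity.
    apply (@is_RInt_scal R_NormedModule).
    apply (@is_RInt_comp_lin R_NormedModule (fun th => ln (2 * sqrt 2 + 2 * cos th))).
    replace (/ 2 * 0 + 0) with 0 by ring. replace (/ 2 * PI + 0) with (PI / 2) by field.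
    apply (@RInt_correct R_CompleteNormedModule).
    apply ex_RInt_continuous_le; [lra|]. intros th Hth.
    assert (Hc := cos_quarter_ge_0 th Hth).
    apply (ex_derive_continuous (V := R_NormedModule)). auto_derive. lra.
Qed.

(** The coefficient of the logarithm is [16 (3 PI / 8) - 8 (PI / 2) = 2 PI]: the first term comes
    from the argument in [BW], the second from the factor [r]. *)
Lemma log_integral_BW :
  8 * log_integral = 16 * BW (0, 1 + sqrt 2) + 2 * PI * ln (1 + sqrt 2).
Proof.
  assert (Hp := sqrt2_gt).
  rewrite BW_imag, atan_1_plus_sqrt2, (quarter_log_integral (1 + sqrt 2)); [field|lra| |lra].
  rewrite <- inv_sqrt2_minus_1, Rinv_inv, inv_sqrt2_minus_1. ring.
Qed.

(** * Numerical bounds *)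

(** Reduces the bounds on [atan] and [ln] below to the sign of an explicit derivative. *)
Lemma nonneg_of_derive (f f' : R -> R) (x : R) :
  0 <= x -> f 0 = 0 ->
  (forall t, 0 <= t <= x -> is_derive f t (f' t) /\ 0 <= f' t) -> 0 <= f x.
Proof.
  intros Hx H0 H.
  destruct (MVT_gen f 0 x f') as [c [Hc Heq]].
  - rewrite Rmin_left, Rmax_right by exact Hx. intros t Ht. apply H. lra.
  - rewrite Rmin_left, Rmax_right by exact Hx. intros t Ht.
    apply continuity_pt_filterlim, (ex_derive_continuous (V := R_NormedModule)).
    eexists. now apply H.
  - rewrite Rmin_left, Rmax_right in Hc by exact Hx. destruct (H c Hc). nra.
Qed.

Lemma atan_ge_cubic (x : R) : 0 <= x -> x - x ^ 3 / 3 <= atan x.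
Proof.
  intros Hx.
  enough (0 <= atan x - (x - x ^ 3 / 3)) by lra.
  apply (nonneg_of_derive (fun t => atan t - (t - t ^ 3 / 3))
    (fun t => t ^ 4 / (1 + t ^ 2))); [exact Hx | rewrite atan_0; lra |].
  intros t Ht. assert (0 < 1 + t ^ 2) by nra. split.
  - auto_derive; [trivial|]. field. nra.
  - apply Rdiv_le_0_compat; [apply pow_le|]; lra.
Qed.

(* Truncated series whose last term is halved, since [1 / (1 + y) <= 1 - y / 2] on [0, 1];
   the same device gives [tet_upper]. *)
Definition atan_upper (x : R) : R :=
  x - x ^ 3 / 3 + x ^ 5 / 5 - x ^ 7 / 7 + x ^ 9 / 9 - x ^ 11 / 22.

Lemma atan_le_upper (x : R) : 0 <= x <= 1 -> atan x <= atan_upper x.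
Proof.
  intros Hx. unfold atan_upper.
  enough (0 <= x - x ^ 3 / 3 + x ^ 5 / 5 - x ^ 7 / 7 + x ^ 9 / 9 - x ^ 11 / 22 - atan x) by lra.
  apply (nonneg_of_derive
    (fun t => t - t ^ 3 / 3 + t ^ 5 / 5 - t ^ 7 / 7 + t ^ 9 / 9 - t ^ 11 / 22 - atan t)
    (fun t => t ^ 10 * (1 - t ^ 2) / (2 * (1 + t ^ 2)))); [apply Hx | rewrite atan_0; lra |].
  intros t Ht. assert (0 < 1 + t ^ 2) by nra. split.
  - auto_derive; [trivial|]. field. nra.
  - apply Rdiv_le_0_compat; [apply Rmult_le_pos; [apply pow_le; lra | nra] | lra].
Qed.

(** The left side is Catalan's constant, a quarter of [v_oct]; [atan_upper s / s] is integrated term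
    by term. *)
Lemma quarter_log_quad_1_le :
  quarter_log_quad 1 / 2 <= 1 - 1 / 9 + 1 / 25 - 1 / 49 + 1 / 81 - 1 / 242.
Proof.
  assert (H := is_RInt_atan_div 1 ltac:(lra)).
  set (P := fun s => s - s ^ 3 / 9 + s ^ 5 / 25 - s ^ 7 / 49 + s ^ 9 / 81 - s ^ 11 / 242).
  assert (HP : is_RInt (fun s => 1 - s ^ 2 / 3 + s ^ 4 / 5 - s ^ 6 / 7 + s ^ 8 / 9 - s ^ 10 / 22)
    0 1 (minus (P 1) (P 0))).
  { apply (is_RInt_derive P); intros s _.
    - unfold P. auto_derive; [trivial | field].
    - apply (ex_derive_continuous (V := R_NormedModule)). auto_derive. trivial. }
  replace (1 - 1 / 9 + 1 / 25 - 1 / 49 + 1 / 81 - 1 / 242) with (minus (P 1) (P 0))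
    by (unfold P, minus, plus, opp; simpl; field).
  rewrite <- (is_RInt_unique _ _ _ _ H), <- (is_RInt_unique _ _ _ _ HP).
  apply RInt_le; [lra | eexists; exact H | eexists; exact HP |].
  intros s Hs. rewrite Rmult_1_r. assert (Ha := atan_le_upper s ltac:(lra)).
  apply Rmult_le_reg_r with s; [lra|]. unfold atan_upper in Ha.
  unfold Rdiv at 1. rewrite Rmult_assoc, Rinv_l, Rmult_1_r by lra. nra.
Qed.

Lemma quarter_log_quad_ge (b : R) : 0 <= b -> b - b ^ 3 / 9 <= quarter_log_quad b / 2.
Proof.
  intros Hb. assert (H := is_RInt_atan_div b Hb).
  set (P := fun s => s * b - s ^ 3 * b ^ 3 / 9).
  assert (HP : is_RInt (fun s => b - s ^ 2 * b ^ 3 / 3) 0 1 (minus (P 1) (P 0))).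
  { apply (is_RInt_derive P); intros s _.
    - unfold P. auto_derive; [trivial | field].
    - apply (ex_derive_continuous (V := R_NormedModule)). auto_derive. trivial. }
  replace (b - b ^ 3 / 9) with (minus (P 1) (P 0))
    by (unfold P, minus, plus, opp; simpl; field).
  rewrite <- (is_RInt_unique _ _ _ _ H), <- (is_RInt_unique _ _ _ _ HP).
  apply RInt_le; [lra | eexists; exact HP | eexists; exact H |].
  intros s Hs. assert (Ha := atan_ge_cubic (s * b) ltac:(nra)).
  apply Rmult_le_reg_r with s; [lra|].
  unfold Rdiv at 2. rewrite Rmult_assoc, Rinv_l, Rmult_1_r by lra. nra.
Qed.

(* [(sqrt 3 / 2) / (1 - s + s^2)] is the derivative of the arctangent, and
   [1 / (1 - s + s^2) = (1 + s) / (1 + s^3)]. *)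
Definition tet_upper (s : R) : R :=
  s + s ^ 2 / 2 - s ^ 4 / 4 - s ^ 5 / 5 + s ^ 7 / 7 + s ^ 8 / 8 - s ^ 10 / 20 - s ^ 11 / 22.

Lemma atan_tet_le (s : R) :
  0 <= s <= 1 ->
  atan (s * (1 * (sqrt 3 / 2)) / (1 + s * (1 * (-1 / 2)))) <= sqrt 3 / 2 * tet_upper s.
Proof.
  intros Hs. unfold tet_upper.
  assert (H3 : sqrt 3 * sqrt 3 = 3) by (apply sqrt_sqrt; lra).
  assert (H3p : 0 < sqrt 3) by (apply sqrt_lt_R0; lra).
  enough (0 <= sqrt 3 / 2 * (s + s ^ 2 / 2 - s ^ 4 / 4 - s ^ 5 / 5 + s ^ 7 / 7 + s ^ 8 / 8
     - s ^ 10 / 20 - s ^ 11 / 22)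
    - atan (s * (1 * (sqrt 3 / 2)) / (1 + s * (1 * (-1 / 2))))) by lra.
  apply (nonneg_of_derive
    (fun s => sqrt 3 / 2 * (s + s ^ 2 / 2 - s ^ 4 / 4 - s ^ 5 / 5 + s ^ 7 / 7 + s ^ 8 / 8
       - s ^ 10 / 20 - s ^ 11 / 22)
      - atan (s * (1 * (sqrt 3 / 2)) / (1 + s * (1 * (-1 / 2)))))
    (fun s => sqrt 3 / 2 * (s ^ 9 * (1 - s ^ 3) / (2 * (1 - s + s ^ 2))))).
  - apply Hs.
  - replace (0 * (1 * (sqrt 3 / 2)) / (1 + 0 * (1 * (-1 / 2)))) with 0 by field.
    rewrite atan_0. field.
  - intros t Ht. assert (Hq : 0 < 1 - t + t ^ 2) by nra. split.
    + set (c := sqrt 3) in *. assert (Hc : c ^ 2 = 3) by nra.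
      auto_derive; [lra|].
      assert (Hw : (1 - t / 2) ^ 2 + c ^ 2 * t ^ 2 / 4 = 1 - t + t ^ 2) by (rewrite Hc; field).
      (* The first product is the derivative of [tet_upper], with the series of [1 / (1 + t^3)] cut
         off and its last term halved. *)
      transitivity (c / 2 * ((1 + t) * (1 - t ^ 3 + t ^ 6 - t ^ 9 / 2))
        - c / 2 / ((1 - t / 2) ^ 2 + c ^ 2 * t ^ 2 / 4)).
      * field. repeat split; nra.
      * rewrite Hw. field. lra.
    + apply Rmult_le_pos; [lra|]. apply Rdiv_le_0_compat; [|lra].
      apply Rmult_le_pos; [apply pow_le; lra|].
      assert (t ^ 3 <= 1 ^ 3) by (apply pow_incr; lra). lra.
Qed.

(** Since [1 - s e^(i PI/3) = 1 + s e^(-2 i PI/3)], minus its argument is the arctangent for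
    [al = 2 PI / 3], [r = 1]; the logarithmic term of [BW] vanishes on the unit circle. *)
Lemma v_tet_le :
  v_tet <= sqrt 3 / 2 * (1 + 1 / 4 - 1 / 16 - 1 / 25 + 1 / 49 + 1 / 64 - 1 / 200 - 1 / 242).
Proof.
  assert (HPI := PI_RGT_0).
  (* With [k = 1 / 2] the value [r = 1] satisfies [r * k < 1]. *)
  assert (Hk : forall th, 0 <= th <= 2 * (PI / 3) -> - (1 / 2) <= cos th).
  { intros th Hth. replace (- (1 / 2)) with (cos (2 * (PI / 3))) by (rewrite cos_2PI3; lra).
    apply cos_decr_1; lra. }
  assert (H := is_RInt_log_quad (2 * (PI / 3)) (1 / 2) 1 ltac:(lra) Hk ltac:(lra) ltac:(lra)).
  rewrite sin_2PI3, cos_2PI3 in H.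
  set (V := RInt _ _ _) in H.
  apply (is_RInt_scal (V := R_NormedModule) _ _ _ (/ 2)) in H.
  assert (Hv : is_RInt (fun s => atan (s * (1 * (sqrt 3 / 2)) / (1 + s * (1 * (-1 / 2)))) / s)
    0 1 (scal (/ 2) V)).
  { revert H. apply is_RInt_ext. intros s _. unfold scal; simpl; unfold mult; simpl.
    set (x := atan _ / s). field. }
  clear H.
  assert (Htet : v_tet = scal (/ 2) V).
  { unfold v_tet, BW, ImLi2.
    rewrite (Defs_RInt _ 0 1 (opp (scal (/ 2) V))).
    - unfold Cabs, Cnorm2, Cexpi; simpl.
      rewrite (Rplus_comm (_ * _)). assert (Hsc := sin2_cos2 (PI / 3)). unfold Rsqr in Hsc.
      rewrite Hsc, sqrt_1, ln_1. unfold opp; simpl. 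
      rewrite Ropp_involutive. ring.
    - apply (is_RInt_ext (fun s => opp (atan (s * (1 * (sqrt 3 / 2))
        / (1 + s * (1 * (-1 / 2)))) / s))).
      + rewrite Rmin_left, Rmax_right by lra.
        intros s Hs. unfold Carg, Csub, Cof, Cmul, Cexpi, opp; simpl.
        rewrite cos_PI3, sin_PI3.
        destruct (Rlt_dec 0 (1 - (s * (1 / 2) - 0 * (sqrt 3 / 2)))) as [_|Hn]; [|exfalso; lra].
        replace ((0 - _) / _) with (- (s * (1 * (sqrt 3 / 2)) / (1 + s * (1 * (-1 / 2))))).
        * rewrite atan_opp. unfold Rdiv. ring.
        * field. lra.
      + now apply (@is_RInt_opp R_NormedModule). }
  rewrite Htet.
  set (P := fun s => sqrt 3 / 2 * (s + s ^ 2 / 4 - s ^ 4 / 16 - s ^ 5 / 25 + s ^ 7 / 49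
    + s ^ 8 / 64 - s ^ 10 / 200 - s ^ 11 / 242)).
  assert (HP : is_RInt (fun s => sqrt 3 / 2 * (1 + s / 2 - s ^ 3 / 4 - s ^ 4 / 5 + s ^ 6 / 7
    + s ^ 7 / 8 - s ^ 9 / 20 - s ^ 10 / 22)) 0 1 (minus (P 1) (P 0))).
  { apply (is_RInt_derive P); intros s _.
    - unfold P. auto_derive; [trivial | field].
    - apply (ex_derive_continuous (V := R_NormedModule)). auto_derive. trivial. }
  replace (sqrt 3 / 2 * _) with (minus (P 1) (P 0))
    by (unfold P, minus, plus, opp; simpl; field).
  rewrite <- (is_RInt_unique _ _ _ _ Hv), <- (is_RInt_unique _ _ _ _ HP).
  apply RInt_le; [lra | eexists; exact Hv | eexists; exact HP |].
  intros s Hs. assert (Ha := atan_tet_le s ltac:(lra)).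
  apply Rmult_le_reg_r with s; [lra|]. unfold tet_upper in Ha.
  set (c := sqrt 3) in *. set (x := atan _) in *.
  unfold Rdiv at 1. rewrite Rmult_assoc, Rinv_l, Rmult_1_r by lra. nra.
Qed.

Lemma PI_gt_314 : 314 / 100 < PI.
Proof.
  assert (H := Machin.Machin_4_5_239).
  assert (H1 := atan_ge_cubic (/ 5) ltac:(lra)).
  assert (H2 : atan (/ 239) <= / 239).
  { assert (Ha := atan_le_upper (/ 239) ltac:(lra)). unfold atan_upper in Ha. lra. }
  lra.
Qed.

(** With [b = sqrt 2 - 1] one has [1 + sqrt 2 = (1 + b) / (1 - b)], and [ln ((1 + b) / (1 - b))]
    exceeds the partial sums of [2 (b + b^3/3 + b^5/5 + ...)]. *)
Lemma ln_1_plus_sqrt2_gt : 88 / 100 < ln (1 + sqrt 2).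
Proof.
  assert (H2 : sqrt 2 * sqrt 2 = 2) by (apply sqrt_sqrt; lra).
  assert (Hp := sqrt2_gt).
  assert (Hb1 : sqrt 2 < 3 / 2) by nra.
  set (b := sqrt 2 - 1).
  assert (Hln : ln (1 + sqrt 2) = ln (1 + b) - ln (1 - b)).
  { rewrite <- ln_div by (unfold b; lra). f_equal. unfold b.
    field_simplify_eq; [nra|lra]. }
  rewrite Hln.
  assert (H : 0 <= ln (1 + b) - ln (1 - b) - 2 * (b + b ^ 3 / 3 + b ^ 5 / 5)).
  { apply (nonneg_of_derive
      (fun t => ln (1 + t) - ln (1 - t) - 2 * (t + t ^ 3 / 3 + t ^ 5 / 5))
      (fun t => 2 * t ^ 6 / (1 - t ^ 2))).
    - unfold b; lra.
    - rewrite Rplus_0_r, Rminus_0_r, ln_1. field.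
    - unfold b. intros t Ht. assert (0 < 1 - t ^ 2) by nra. split.
      + auto_derive; [lra|]. field. repeat split; nra.
      + apply Rdiv_le_0_compat; [|lra]. assert (0 <= t ^ 6) by (apply pow_le; lra). lra. }
  assert (Hb : 4142 / 10000 <= b) by (unfold b; lra).
  assert (H3 : (4142 / 10000) ^ 3 <= b ^ 3) by (apply pow_incr; lra).
  assert (H5 : (4142 / 10000) ^ 5 <= b ^ 5) by (apply pow_incr; lra).
  lra.
Qed.

(** The root [b = sqrt 2 - 1] gives [8 log_integral >= 16 (b - b^3/9) + 4 PI ln (1 + sqrt 2)]. The
    bounds place this above 17.55 and the volumes below 17.51. *)
Lemma volumes_lt_log_integral : 10 * v_tet + 2 * v_oct < 8 * log_integral.
Proof.
  assert (Ht := v_tet_le). assert (HPI := PI_gt_314). assert (HL := ln_1_plus_sqrt2_gt).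
  assert (Hp := sqrt2_gt).
  assert (H2 : sqrt 2 * sqrt 2 = 2) by (apply sqrt_sqrt; lra).
  assert (H3 : sqrt 3 <= 17321 / 10000).
  { rewrite <- (sqrt_square (17321 / 10000)) by lra. apply sqrt_le_1; lra. }
  assert (Ho : v_oct = 4 * (quarter_log_quad 1 / 2)).
  { unfold v_oct. rewrite BW_imag, ln_1 by lra. ring. }
  assert (H1 := quarter_log_quad_1_le).
  set (b := sqrt 2 - 1) in *.
  assert (Hk : quarter_log_quad b = log_integral + PI / 2 * ln b).
  { apply quarter_log_integral; [unfold b; lra|]. unfold b. rewrite inv_sqrt2_minus_1. ring. }
  assert (Hlb : ln b = - ln (1 + sqrt 2)).
  { rewrite <- inv_sqrt2_minus_1, ln_Rinv by lra. fold b. ring. }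
  assert (Hq := quarter_log_quad_ge b ltac:(unfold b; lra)).
  assert (Hb : 4142 / 10000 <= b <= 4143 / 10000) by (unfold b; nra).
  assert (Hb3 : b ^ 3 <= (4143 / 10000) ^ 3) by (apply pow_incr; lra).
  rewrite Hlb in Hk. nra.
Qed.

Theorem theorem4p6 :
  exists m : R,
    is_mahler_measure pC1 m /\
    2 * PI * m = 16 * BW (0, 1 + sqrt 2) + 2 * PI * ln (1 + sqrt 2) /\
    10 * v_tet + 2 * v_oct < 2 * PI * m.
Proof.
  assert (HPI := PI_RGT_0).
  exists (RInt log_slice 0 (2 * PI) / (4 * PI ^ 2)).
  assert (Hm : 2 * PI * (RInt log_slice 0 (2 * PI) / (4 * PI ^ 2)) = 8 * log_integral).
  { rewrite RInt_log_slice_eq. field. lra. }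
  rewrite Hm. split; [|split].
  - apply is_mahler_measure_pC1.
  - apply log_integral_BW.
  - apply volumes_lt_log_integral.
Qed.
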